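(* For every integer $n\ge1$, the Poincaré polynomial $a_n=a_n(q)$ of the set of fully commutative elements of the Coxeter group $W(A_n)$ is given by $$ \begin{aligned} a_n=\ &\frac{1}{q^{n+2}}\,(q^2+\cdots+q^{n+2})\\ &+\frac{1}{q^{n+2}}\sum_{i=1}^{n}(q^2+\cdots+q^{i+1})\sum_{s=0}^{n-i}(-1)^{s+1}\sum_{n+1=v_0>v_1>\cdots>v_s>v_{s+1}=i}\ \prod_{u=0}^{s}\Bigg[(1-\psi(v_{u+1}))\,\Pi(v_{u+1}+2,v_u)\\ &\quad+\sum_{t=1}^{v_{u+1}-1}(1-\psi(t))\sum_{r=1}^{\min\{v_u-v_{u+1}-1,\,v_{u+1}-t\}}\ \sum_{d_1+\cdots+d_r=v_{u+1}-t}\Sigma\Pi(t+2,v_u)[d_1+1,\dots,d_r+1]\Bigg], \end{aligned} $$ where $\psi(k)=q^2+\cdots+q^{k+1}$ for $k\ge1$, the sum over $v_0>\cdots>v_{s+1}$ runs over all strictly decreasing sequences of integers with $v_0=n+1$ and $v_{s+1}=i$, and the indices $d_1,\dots,d_r$ are positive integers.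
   Context: For a positive integer $n$, $W(A_n)$ is the Coxeter group with generators $\sigma_1,\dots,\sigma_n$ and relations $\sigma_i^2=1$, $\sigma_i\sigma_{i+1}\sigma_i=\sigma_{i+1}\sigma_i\sigma_{i+1}$ for $1\le i\le n-1$, and $\sigma_i\sigma_j=\sigma_j\sigma_i$ for $|i-j|\ge 2$. The length $l(w)$ is the minimal number of generators in an expression of $w$; expressions of this length are called reduced. An element is fully commutative if any of its reduced expressions can be obtained from any other by applying only commutation relations $\sigma_i\sigma_j=\sigma_j\sigma_i$, $|i-j|\ge2$; $W^c(A_n)$ is the set of fully commutative elements of $W(A_n)$, and $a_n=\sum_{w\in W^c(A_n)}q^{l(w)}$. Define $\Pi(a,b)=\prod_{t=a}^{b}(1-q^t)$ for $1\le a\le b$ and $\Pi(a,b)=1$ for $a>b$. Let $l_1,\dots,l_p\ge 2$ be integers and let $i_1,\dots,i_p$ be integers with $a\le i_1$, $i_t+l_t\le i_{t+1}$ for $1\le t<p$, and $i_p+l_p-1\le b$. Then $\Pi(a,b)[i_1(l_1),\dots,i_p(l_p)]$ denotes the polynomial obtained from the product $\Pi(a,b)$ by replacing, for each $t=1,\dots,p$, the subproduct of $l_t$ consecutive factors $(1-q^{i_t})\cdots(1-q^{i_t+l_t-1})$ by the monomial $-q^{i_t}$. Further, $\Sigma\Pi(a,b)[l_1,\dots,l_p]$ is the sum of $\Pi(a,b)[i_1(l_1),\dots,i_p(l_p)]$ over all integer tuples $(i_1,\dots,i_p)$ satisfying $a\le i_1$, $i_t+l_t\le i_{t+1}$ for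 $1\le t<p$, and $i_p+l_p-1\le b$; it is $0$ if there are none. Empty sums are $0$. *)

(* Defs.v *)
From HB Require Import structures.
From Stdlib Require Import Relation_Operators.
From mathcomp Require Import all_boot all_order all_algebra.
From mathcomp Require Import boolp classical_sets fsbigop.

Set Implicit Arguments.
Unset Strict Implicit.
Unset Printing Implicit Defensive.

Import GRing.Theory.

Local Open Scope nat_scope.
Local Open Scope quotient_scope.

(* W(A_n) is the set of words in the generators modulo the congruence
   generated by the Coxeter relations. The generator sigma_(i+1) is indexed by
   i : 'I_n. As the generators are involutions, words without formal inverses
   suffice; cox_gen_sqr, cox_gen_braid, cox_gen_comm, cox_gen_generate and
   cox_group_universal below show that the quotient is the presented group. *)

Inductive cox_eq (n : nat) : seq 'I_n -> seq 'I_n -> Prop :=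
| CoxRefl s : cox_eq s s
| CoxSym s t : cox_eq s t -> cox_eq t s
| CoxTrans s t u : cox_eq s t -> cox_eq t u -> cox_eq s u
| CoxCat s s' t t' : cox_eq s s' -> cox_eq t t' -> cox_eq (s ++ t) (s' ++ t')
| CoxSqr (i : 'I_n) : cox_eq [:: i; i] [::]
| CoxBraid (i j : 'I_n) : j = i.+1 :> nat -> cox_eq [:: i; j; i] [:: j; i; j]
| CoxComm (i j : 'I_n) : (i.+1 < j) || (j.+1 < i) ->
    cox_eq [:: i; j] [:: j; i].

Definition cox_eqb n : rel (seq 'I_n) := fun s t => `[< cox_eq s t >].

Lemma cox_eqb_refl n : reflexive (@cox_eqb n).
Proof. by move=> s; apply/asboolP/CoxRefl. Qed.

Lemma cox_eqb_sym n : symmetric (@cox_eqb n).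
Proof. by move=> s t; apply/asboolP/asboolP => /CoxSym. Qed.

Lemma cox_eqb_trans n : transitive (@cox_eqb n).
Proof.
by move=> t s u /asboolP st /asboolP tu; apply/asboolP/(CoxTrans st tu).
Qed.

Canonical cox_equiv n :=
  EquivRel (@cox_eqb n) (@cox_eqb_refl n) (@cox_eqb_sym n) (@cox_eqb_trans n).

Definition cox_group (n : nat) : Type := {eq_quot (cox_equiv n)}.
HB.instance Definition _ n := Choice.on (cox_group n).
HB.instance Definition _ n := EqQuotient.on (cox_group n).

Lemma cox_eqP n (s t : seq 'I_n) :
  cox_eq s t <-> \pi_(cox_group n) s = \pi_(cox_group n) t.
Proof.
split=> [st|/eqP]; first by apply/eqP; rewrite eqmodE; apply/asboolP.
by rewrite eqmodE => /asboolP.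
Qed.

Lemma cox_eq_repr n (s : seq 'I_n) : cox_eq (repr (\pi_(cox_group n) s)) s.
Proof. by apply/cox_eqP; rewrite reprK. Qed.

Lemma cox_eq_rev n (s t : seq 'I_n) : cox_eq s t -> cox_eq (rev s) (rev t).
Proof.
elim=> {s t} [s|s t _|s t u _ IH1 _ IH2|s s' t t' _ IH1 _ IH2|i|i j ij|i j ij].
- exact: CoxRefl.
- exact: CoxSym.
- exact: CoxTrans IH1 IH2.
- by rewrite !rev_cat; apply: CoxCat.
- exact: CoxSqr.
- exact: CoxBraid.
- by apply: CoxComm; rewrite orbC.
Qed.

Lemma cox_eq_revV n (s : seq 'I_n) : cox_eq (rev s ++ s) [::].
Proof.
elim: s => [|i s IHs] /=; first exact: CoxRefl.
rewrite rev_cons cat_rcons.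
apply: CoxTrans IHs; apply: CoxCat; first exact: CoxRefl.
by apply: (CoxCat (s := [:: i; i]) (s' := [::])); [apply: CoxSqr|apply: CoxRefl].
Qed.

Definition cox_one n : cox_group n := \pi_(cox_group n) [::].
Definition cox_mul n (x y : cox_group n) : cox_group n :=
  \pi_(cox_group n) (repr x ++ repr y).
Definition cox_inv n (x : cox_group n) : cox_group n :=
  \pi_(cox_group n) (rev (repr x)).

Lemma cox_mulA n : associative (@cox_mul n).
Proof.
move=> x y z; apply/cox_eqP; apply: (@CoxTrans _ _ (repr x ++ repr y ++ repr z)).
  by apply: CoxCat; [apply: CoxRefl|apply: cox_eq_repr].
rewrite catA; apply: CoxSym.
by apply: CoxCat; [apply: cox_eq_repr|apply: CoxRefl].
Qed.

Lemma cox_mul1 n : left_id (@cox_one n) (@cox_mul n).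
Proof.
move=> x; rewrite -[RHS]reprK; apply/cox_eqP.
by apply: (@CoxCat _ _ [::]); [apply: cox_eq_repr|apply: CoxRefl].
Qed.

Lemma cox_mulr1 n : right_id (@cox_one n) (@cox_mul n).
Proof.
move=> x; rewrite -[RHS]reprK; apply/cox_eqP; rewrite -[X in cox_eq _ X]cats0.
by apply: CoxCat; [apply: CoxRefl|apply: cox_eq_repr].
Qed.

Lemma cox_mulV n : left_inverse (@cox_one n) (@cox_inv n) (@cox_mul n).
Proof.
move=> x; apply/cox_eqP; apply: CoxTrans (cox_eq_revV (repr x)).
by apply: CoxCat; [apply: cox_eq_repr|apply: CoxRefl].
Qed.

Lemma cox_mulrV n : right_inverse (@cox_one n) (@cox_inv n) (@cox_mul n).
Proof.
move=> x; apply/cox_eqP; apply: CoxTrans (cox_eq_revV (rev (repr x))).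
by rewrite revK; apply: CoxCat; [apply: CoxRefl|apply: cox_eq_repr].
Qed.

HB.instance Definition _ n := isGroup.Build (cox_group n)
  (@cox_mulA n) (@cox_mul1 n) (@cox_mulr1 n) (@cox_mulV n) (@cox_mulrV n).

Definition cox_gen n (i : 'I_n) : cox_group n := \pi_(cox_group n) [:: i].

Definition cox_prod n (s : seq 'I_n) : cox_group n :=
  \big[*%g/1%g]_(i <- s) cox_gen i.

Lemma cox_prodE n (s : seq 'I_n) : cox_prod s = \pi_(cox_group n) s.
Proof.
rewrite /cox_prod; elim: s => [|i s IHs]; first by rewrite big_nil.
rewrite big_cons IHs; apply/cox_eqP.
by apply: (@CoxCat _ _ [:: i]); apply: cox_eq_repr.
Qed.

Lemma cox_prod_eq n (s t : seq 'I_n) : cox_prod s = cox_prod t <-> cox_eq s t.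
Proof. by rewrite !cox_prodE; apply: iff_sym; apply: cox_eqP. Qed.

Lemma cox_gen_sqr n (i : 'I_n) : (cox_gen i * cox_gen i = 1)%g.
Proof.
have := (cox_prod_eq [:: i; i] [::]).2 (CoxSqr i).
by rewrite /cox_prod !big_cons !big_nil mulg1.
Qed.

Lemma cox_gen_braid n (i j : 'I_n) : j = i.+1 :> nat ->
  (cox_gen i * cox_gen j * cox_gen i = cox_gen j * cox_gen i * cox_gen j)%g.
Proof.
move=> ij; have := (cox_prod_eq [:: i; j; i] [:: j; i; j]).2 (CoxBraid ij).
by rewrite /cox_prod !big_cons !big_nil !mulg1 !mulgA.
Qed.

Lemma cox_gen_comm n (i j : 'I_n) : (i.+1 < j) || (j.+1 < i) ->
  (cox_gen i * cox_gen j = cox_gen j * cox_gen i)%g.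
Proof.
move=> ij; have := (cox_prod_eq [:: i; j] [:: j; i]).2 (CoxComm ij).
by rewrite /cox_prod !big_cons !big_nil !mulg1.
Qed.

Lemma cox_gen_generate n (w : cox_group n) :
  exists s : seq 'I_n, cox_prod s = w.
Proof. by exists (repr w); rewrite cox_prodE reprK. Qed.

Lemma cox_group_universal n (G : groupType) (tau : 'I_n -> G) :
  (forall i, tau i * tau i = 1)%g ->
  (forall i j : 'I_n, j = i.+1 :> nat ->
     tau i * tau j * tau i = tau j * tau i * tau j)%g ->
  (forall i j : 'I_n, (i.+1 < j) || (j.+1 < i) ->
     tau i * tau j = tau j * tau i)%g ->
  exists! f : cox_group n -> G,
    {morph f : x y / (x * y)%g} /\ forall i, f (cox_gen i) = tau i.
Proof.
move=> tau2 tauB tauC; pose g (s : seq 'I_n) := (\big[*%g/1]_(i <- s) tau i)%g.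
have gP s t : cox_eq s t -> g s = g t.
  elim=> {s t} // [s t u _ -> _ -> //|s s' t t' _ IH1 _ IH2|i|i j ij|i j ij].
  - by rewrite /g !big_cat /=; congr (_ * _)%g.
  - by rewrite /g !big_cons !big_nil !mulg1.
  - by rewrite /g !big_cons !big_nil !mulg1 !mulgA; apply: tauB.
  - by rewrite /g !big_cons !big_nil !mulg1; apply: tauC.
have gr s : g (repr (\pi_(cox_group n) s)) = g s by apply/gP/cox_eq_repr.
exists (fun w => g (repr w)); split; first split.
- by move=> x y; rewrite [LHS]gr /g big_cat.
- by move=> i; rewrite gr /g big_seq1.
move=> f [fM fgen]; apply/funext => w.
rewrite -[in RHS](reprK w); elim: (repr w) => [|i s IHs].
  rewrite /g big_nil; have := fM 1%g 1%g; rewrite mulg1 => /esym/eqP.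
  by rewrite -[X in _ == X]mulg1 (can_eq (mulKg _)) => /eqP.
have -> : \pi_(cox_group n) (i :: s) = (cox_gen i * \pi_(cox_group n) s)%g.
  by rewrite -!cox_prodE /cox_prod big_cons.
by rewrite fM fgen -IHs /g big_cons.
Qed.

Lemma cox_length_subproof n (w : cox_group n) :
  exists k, [exists s : k.-tuple 'I_n, cox_prod s == w].
Proof.
have [s <-] := cox_gen_generate w.
by exists (size s); apply/existsP; exists (in_tuple s).
Qed.

Definition cox_length n (w : cox_group n) : nat :=
  ex_minn (cox_length_subproof w).

Definition reduced n (w : cox_group n) (s : seq 'I_n) : Prop :=
  cox_prod s = w /\ size s = cox_length w.

Inductive comm_step n : seq 'I_n -> seq 'I_n -> Prop :=
  CommStep (s t : seq 'I_n) (i j : 'I_n) : (i.+1 < j) || (j.+1 < i) ->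
    comm_step (s ++ [:: i; j] ++ t) (s ++ [:: j; i] ++ t).

Definition fully_commutative n : set (cox_group n) :=
  [set w | forall s t, reduced w s -> reduced w t ->
             clos_refl_trans _ (@comm_step n) s t]%classic.
Arguments fully_commutative : clear implicits.

Local Open Scope ring_scope.

(* The finitely supported sum is the genuine sum over all fully commutative
   elements, W(A_n) being finite; it would be 0 on an infinite set. *)
Definition fc_poincare (n : nat) : {poly int} :=
  \sum_(w \in fully_commutative n) ('X^(cox_length w) : {poly int}).

Definition psi (k : nat) : {poly int} := \sum_(2 <= j < k.+2) 'X^j.

(* i_1(l_1), ..., i_p(l_p) is encoded by the lists l = [l_1; ...; l_p] and
   i = [i_1; ...; i_p], which are read from index 0 on. *)

Definition block_admissible (a b : nat) (l i : seq nat) : bool :=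
  [&& a <= nth 0 i 0,
      [forall t : 'I_(size l).-1,
         nth 0 i t + nth 0 l t <= nth 0 i t.+1] &
      nth 0 i (size l).-1 + nth 0 l (size l).-1 <= b.+1]%N.

Definition in_block (l i : seq nat) (j : nat) : bool :=
  [exists t : 'I_(size l), nth 0 i t <= j < nth 0 i t + nth 0 l t]%N.

Definition Pi (a b : nat) : {poly int} := \prod_(a <= t < b.+1) (1 - 'X^t).

Definition Pi_blocks (a b : nat) (l i : seq nat) : {poly int} :=
  (\prod_(a <= j < b.+1 | ~~ in_block l i j) (1 - 'X^j)) *
  \prod_(t < size l) (- 'X^(nth 0%N i t)).

Definition nat_vals (m k : nat) (v : k.-tuple 'I_m) : seq nat :=
  [seq nat_of_ord x | x <- v].

(* Admissibility forces i_t <= b, so every admissible tuple is met. *)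
Definition SigmaPi (a b : nat) (l : seq nat) : {poly int} :=
  \sum_(i : (size l).-tuple 'I_b.+1 | block_admissible a b l (nat_vals i))
     Pi_blocks a b l (nat_vals i).

Definition is_composition (m : nat) (d : seq nat) : bool :=
  all (fun x => 0 < x)%N d && (sumn d == m).

(* v = [v_0; ...; v_(s+1)] with n+1 = v_0 > v_1 > ... > v_(s+1) = i. *)
Definition is_chain (n i s : nat) (v : seq nat) : bool :=
  [&& nth 0%N v 0 == n.+1, nth 0%N v s.+1 == i & sorted gtn v].

Notation "x %:F" := (FracField.tofrac x) : ring_scope.

(* Main.v *)
Require Import Defs.
From Stdlib Require Import Relation_Operators.
From mathcomp Require Import boolp classical_sets fsbigop.
From mathcomp Require Import all_boot all_order all_algebra.
From mathcomp Require Import zify ring.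

(** Write q for the variable, a_m for the generating function of the fully
    commutative elements of type A_m, and b_m = q^(m+1) a_(m-1).  Summing over
    decreasing chains with the sign (-1)^(s+1) expands the inverse of a lower
    unitriangular matrix I + M, where M(v, w) is the bracket of the formula
    with v = v_u and w = v_(u+1).  The formula for b_(n+1) therefore says that
      b_m + sum_(1 <= w < m) M(m, w) b_w = psi(m)       for 1 <= m <= n+1
    ([unitriangular_inverse], [sum_is_chain]), and the substance of the proof
    is this system ([tiling_kernel_system]).

    The elements are counted by normal words: products of descending runs
    i, i-1, ..., j in which both the first and the last letters of the runs
    strictly increase.  Inserting letters one at a time turns any word, by
    commutations, into a normal word or into a word with a factor ii or iji
    ([normal_insert]); the second case cannot occur for a reduced expression of
    a fully commutative element.  Conversely, each letter of a normal word
    creates an inversion, so the word is reduced; its permutation avoids 321,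
    which keeps factors iji out of all its reduced expressions; and the
    permutation determines the normal word ([reduced_commute]).  Let e(m, b)
    count the normal words with letters below m whose runs all end below b, so
    that a_m = e(m, m).  Removing the last run gives, for b <= m,
      e(m+1, b+1) - e(m+1, b) = e(m, b+1) - e(m, b) + q^(m+1-b) e(m, b)
    ([normal_gf_step]).

    On the other side, M(v, w) = sum_(1 <= t <= w) (1 - psi(t)) G_v(t+2, w-t),
    where G_b(a, k) adds up the tilings of the interval from a to b by single
    points j of weight 1 - q^j and blocks of weight -q^i with first point i,
    the block lengths minus one adding up to k ([block_kernelE]).  Looking at
    the first tile yields a recurrence in a with three terms for q^k G_b(a, k)
    ([tilings_three_term]).  Fix b = m and put
      V_k(j, a) = sum_i q^i G_m(a, i) e(j+i+k, j+i).
    Since psi(t) - psi(t-1) = q^(t+1) occurs as a coefficient of the recurrence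
    in a, the sum over t telescopes, twice, and leaves V_0(0, 2) - V_0(0, 1)
    ([telescope_columns]).  By the recurrence for e this difference can be
    moved to the right end of the interval ([telescope_rows]), where it is
    e(m, 1) - e(m, 0) = q + ... + q^m = psi(m) / q. *)

Set Implicit Arguments.
Unset Strict Implicit.
Unset Printing Implicit Defensive.

Import GRing.Theory.

Local Open Scope ring_scope.
Local Open Scope nat_scope.

(** * Words as paths of points *)

(** The conditionals are split innermost first, so that every condition handed
    to [lia] is free of conditionals. *)
Ltac if_lia := repeat match goal with
  | |- context [if ?b then _ else _] =>
      lazymatch b with context [if _ then _ else _] => fail
      | _ => case: (boolP b) => ? end
  | H : context [if ?b then _ else _] |- _ =>
      lazymatch b with context [if _ then _ else _] => fail
      | _ => move: H; case: (boolP b) => ? H end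
  end; try lia.

Definition swap (i x : nat) : nat :=
  if x == i then i.+1 else if x == i.+1 then i else x.

(** The symmetric group enters only through the paths of single points; no
    bound on the letters is built in, so that one definition serves all
    ranks. *)
Definition track (s : seq nat) (x : nat) : nat :=
  foldl (fun y i => swap i y) x s.

Lemma swapK i : involutive (swap i).
Proof. by move=> x; rewrite /swap; if_lia. Qed.

Lemma track_cat s t x : track (s ++ t) x = track t (track s x).
Proof. exact: foldl_cat. Qed.

Lemma track_rcons s c x : track (rcons s c) x = swap c (track s x).
Proof. by rewrite -cats1 track_cat. Qed.

Lemma track_rev s x : track s (track (rev s) x) = x.
Proof.
elim: s x => [|c s IHs] x //.
by rewrite rev_cons track_rcons /= swapK IHs.
Qed.

Lemma track_inj s : injective (track s).
Proof.
apply: (can_inj (g := track (rev s))) => x.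
by rewrite -{2}(revK s) track_rev.
Qed.

Lemma track_cox_eq n (s t : seq 'I_n) :
  cox_eq s t -> track (map val s) =1 track (map val t).
Proof.
elim=> {s t} [s|s t _ IH|s t u _ IH1 _ IH2|s s' t t' _ IH1 _ IH2|i|i j ij|i j ij] x.
- by [].
- by rewrite IH.
- by rewrite IH1 IH2.
- by rewrite !map_cat !track_cat IH1 IH2.
- by rewrite /= swapK.
- by rewrite /= ij /swap; if_lia.
- by rewrite /= /swap; if_lia.
Qed.

(** Inversions are recorded as pairs of points and not of positions: appending
    a letter then affects a single pair. *)
Definition inversions (N : nat) (s : seq nat) : {set 'I_N * 'I_N} :=
  [set p : 'I_N * 'I_N | (p.1 < p.2) && (track s p.2 < track s p.1)].

Definition ascent N (s : seq nat) (c : nat) (p : 'I_N * 'I_N) : bool :=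
  [&& p.1 < p.2, track s p.1 == c & track s p.2 == c.+1].

Lemma ltn_swap c a b : a != b -> ~~ ((a == c) && (b == c.+1)) ->
  swap c b < swap c a -> b < a.
Proof. by rewrite /swap; if_lia. Qed.

(** The letter c exchanges the points at positions c and c.+1 and does not
    change the relative order of any other two points. *)
Lemma ascent_inversions N s c (p : 'I_N * 'I_N) : ascent s c p ->
  p \notin inversions N s /\
  inversions N (rcons s c) = p |: inversions N s.
Proof.
move=> /and3P[lt_p /eqP p1c /eqP p2c]; split.
  by rewrite inE lt_p p1c p2c -leqNgt /=.
apply/setP => r; rewrite !inE !track_rcons.
have [-> /=|ne_rp /=] := eqVneq r p.
  by rewrite lt_p p1c p2c /swap; if_lia.
have [lt_r /=|//] := boolP (r.1 < r.2).
have neT : track s r.1 != track s r.2.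
  by apply: contraTneq lt_r => /track_inj ->; rewrite ltnn.
have noasc : ~~ ((track s r.1 == c) && (track s r.2 == c.+1)).
  apply: contra ne_rp; case: r p p1c p2c {lt_r lt_p neT} => r1 r2 [p1 p2] /=.
  by move=> <- <- /andP[/eqP/track_inj/val_inj-> /eqP/track_inj/val_inj->].
have nodesc : ~~ ((track s r.2 == c) && (track s r.1 == c.+1)).
  apply/negP; rewrite -{1}p1c -p2c => /andP[/eqP/track_inj e2 /eqP/track_inj e1].
  by move: lt_r lt_p; rewrite e1 e2; lia.
apply/idP/idP; first exact: ltn_swap.
move=> lt_t; apply: (@ltn_swap c); rewrite ?swapK //.
- by apply: contraNneq neT => /(inv_inj (@swapK c)) ->.
- by move: noasc nodesc neT lt_t; rewrite /swap; if_lia.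
Qed.

Lemma inversions_rcons N s c :
  (exists2 p : 'I_N * 'I_N, ascent s c p &
     inversions N (rcons s c) = p |: inversions N s /\
     #|inversions N (rcons s c)| = #|inversions N s|.+1) \/
  #|inversions N (rcons s c)| <= #|inversions N s|.
Proof.
have [p ascp|noasc] := pickP (@ascent N s c).
  have [pNin eqI] := ascent_inversions ascp.
  by left; exists p => //; rewrite eqI cardsU1 pNin.
right; apply/subset_leq_card/subsetP => r.
rewrite !inE !track_rcons => /andP[lt_r]; rewrite lt_r /=.
apply: ltn_swap; last by have := noasc r; rewrite /ascent lt_r /= => ->.
by apply: contraTneq lt_r => /track_inj ->; rewrite ltnn.
Qed.

Lemma card_inversions N s : #|inversions N s| <= size s.
Proof.
elim/last_ind: s => [|s c IHs].
  rewrite leqn0 cards_eq0; apply/eqP/setP => p; rewrite !inE /=; lia.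
by rewrite size_rcons; case: (inversions_rcons N s c) => [[p _ [_ ->]]|]; lia.
Qed.

(** By [card_inversions] such a word is a shortest one for its permutation, and
    none of its letters undoes an inversion. *)
Definition geodesic N s : Prop := #|inversions N s| = size s.

Lemma geodesic_rcons N s c : geodesic N (rcons s c) ->
  geodesic N s /\ exists2 p : 'I_N * 'I_N, ascent s c p &
     inversions N (rcons s c) = p |: inversions N s.
Proof.
rewrite /geodesic size_rcons; have := card_inversions N s.
case: (inversions_rcons N s c) => [[p ascp [eqI ->]]|]; last by lia.
by move=> _ [->]; split=> //; exists p.
Qed.

Lemma geodesic_cat N s t : geodesic N (s ++ t) ->
  geodesic N s /\ inversions N s \subset inversions N (s ++ t).
Proof.
elim/last_ind: t => [|t c IHt]; first by rewrite cats0.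
rewrite -rcons_cat => /geodesic_rcons[/IHt[gs sub_s] [p _ ->]]; split=> //.
exact: subset_trans sub_s (subsetUr _ _).
Qed.

Inductive square_or_braid : seq nat -> Prop :=
| SquareFactor s t i : square_or_braid (s ++ [:: i; i] ++ t)
| BraidFactor s t i j : (j == i.+1) || (i == j.+1) ->
    square_or_braid (s ++ [:: i; j; i] ++ t).

(** The pattern is read off the map from points to positions, which is the
    inverse of the one-line notation; 321 is its own inverse. *)
Definition avoids321 s : Prop := forall x y z, x < y -> y < z ->
  ~ (track s z < track s y /\ track s y < track s x).

(** In a geodesic word a factor iji leaves three points in reverse order, and
    inversions, once created, persist to the end of the word.  A factor ii
    would undo the inversion that its first letter creates. *)
Lemma geodesic_avoids321 N s : geodesic N s -> avoids321 s ->
  ~ square_or_braid s.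
Proof.
move=> + + bad_s; case: s / bad_s => [s t i|s t i j ij].
  have -> : s ++ [:: i; i] ++ t = rcons (rcons s i) i ++ t.
    by rewrite -!cats1 -!catA.
  move=> /geodesic_cat[/geodesic_rcons[]] /geodesic_rcons[_] [p pP _].
  move=> [r rP _] _ _; move: rP; rewrite /ascent !track_rcons.
  move: pP; rewrite /ascent => /and3P[ltp /eqP p1 /eqP p2] /and3P[ltr r1 r2].
  have /track_inj e1 : track s r.1 = track s p.2 by move: r1 r2; rewrite /swap; if_lia.
  have /track_inj e2 : track s r.2 = track s p.1 by move: r1 r2; rewrite /swap; if_lia.
  by move: ltp ltr; rewrite e1 e2; lia.
set u := rcons (rcons (rcons s i) j) i.
have -> : s ++ [:: i; j; i] ++ t = u ++ t by rewrite /u -!cats1 -!catA.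
move=> /geodesic_cat[gu sub_u] avoid.
have [g2 [p3 p3P _]] := geodesic_rcons gu.
have [g1 [p2 p2P _]] := geodesic_rcons g2.
have [_ [p1 p1P _]] := geodesic_rcons g1.
move: p1P p2P p3P; rewrite /ascent !track_rcons.
move=> /and3P[lt1 /eqP a1 /eqP b1] /and3P[lt2 a2 b2] /and3P[lt3 a3 b3].
have in_u (x y : 'I_N) : x < y -> track u y < track u x ->
    track (u ++ t) y < track (u ++ t) x.
  move=> ltxy ltu; have : (x, y) \in inversions N u by rewrite inE ltxy.
  by move=> /(subsetP sub_u); rewrite inE => /andP[].
have tu x : track u x = swap i (swap j (swap i (track s x))).
  by rewrite !track_rcons.
have u3 : track u p3.2 < track u p3.1.
  by rewrite !tu (eqP a3) (eqP b3) /swap; if_lia.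
have {ij}[eij|eij] : j = i.+1 \/ i = j.+1 by lia.
  have /track_inj/val_inj e2 : track s p3.1 = track s p1.2.
    by move: a3; rewrite b1 /swap; if_lia.
  apply: (avoid p1.1 p3.1 p3.2) => //; first by rewrite e2.
  split; apply: in_u => //; first by rewrite e2.
  by rewrite !tu (eqP a3) a1 /swap; if_lia.
have /track_inj/val_inj e2 : track s p3.2 = track s p1.1.
  by move: b3; rewrite a1 /swap; if_lia.
apply: (avoid p3.1 p3.2 p1.2) => //; first by rewrite e2.
split; apply: in_u => //; first by rewrite e2.
by rewrite !tu (eqP b3) b1 /swap; if_lia.
Qed.

(** * Normal words *)

Definition block (i j : nat) : seq nat := rev (iota j (i.+1 - j)).

Lemma block_rcons i j : j <= i -> block i j = rcons (block i j.+1) j.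
Proof. by move=> le_ji; rewrite /block subSn // subSS rev_cons. Qed.

Lemma block_nil i : block i i.+1 = [::].
Proof. by rewrite /block subnn. Qed.

Lemma size_block i j : size (block i j) = i.+1 - j.
Proof. by rewrite size_rev size_iota. Qed.

Lemma track_block i j x : j <= i.+1 ->
  track (block i j) x =
  if x == i.+1 then j else if j <= x <= i then x.+1 else x.
Proof.
have [d] := ubnP (i.+1 - j); elim: d j => // d IHd j lt_d le_j.
have [->|ne_j] := eqVneq j i.+1; first by rewrite block_nil /=; if_lia.
rewrite block_rcons ?track_rcons; last by lia.
by rewrite IHd; rewrite /swap; if_lia.
Qed.

(** The strict bounds m on the letters and b on the last letters of the runs
    are what the next run has to respect; carrying them as indices makes the
    two chains of inequalities part of the induction. *)
Inductive normal : nat -> nat -> seq nat -> Prop :=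
| NormalNil m b : normal m b [::]
| NormalBlock m b i j u : normal i j u -> j <= i -> i < m -> j < b ->
    normal m b (u ++ block i j).

Lemma normal_fix m b u x : normal m b u -> m < x -> track u x = x.
Proof.
move=> nu; elim: nu x => {m b u} // m b i j u _ IHu le_ji lt_im lt_jb x lt_mx.
by rewrite track_cat IHu ?track_block; if_lia.
Qed.

Lemma normal_le m b u x : normal m b u -> x <= m -> track u x <= m.
Proof.
move=> nu le_xm; rewrite leqNgt; apply/negP => lt_m.
have := normal_fix nu lt_m => /track_inj eqx.
by move: lt_m; rewrite eqx ltnNge le_xm.
Qed.

(** A run inserts a new largest point at position j, and everything to the right
    of it increases.  This is what prevents the next run, which ends further
    right, from creating a pattern 321. *)
Lemma normal_mono m b u x y : normal m b u -> x < y ->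
  b <= track u x -> b <= track u y -> track u x < track u y.
Proof.
move=> nu; elim: nu x y => {m b u} // m b i j u nu IHu le_ji lt_im lt_jb x y lt_xy.
rewrite !track_cat !track_block; try by lia.
have fix_i := normal_fix nu.
have le_i := normal_le nu.
have [lt_iy|le_yi] := ltnP i y.
  rewrite (fix_i y lt_iy).
  have [lt_ix|le_xi] := ltnP i x; first by rewrite fix_i //; if_lia.
  by have := le_i x le_xi; if_lia.
have le_xi : x <= i by lia.
have := IHu x y lt_xy; have := le_i x le_xi; have := le_i y le_yi; if_lia.
Qed.

(** The last run moves the largest point only, so a new pattern would consist of
    that point and of two points that [normal_mono] puts in order. *)
Lemma normal_avoids321 m b u : normal m b u -> avoids321 u.
Proof.
elim=> {m b u} [m b|m b i j u nu IHu le_ji lt_im lt_jb] x y z lt_xy lt_yz.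
  by move=> /=; lia.
rewrite !track_cat !track_block; try by lia.
have fix_i := normal_fix nu.
have le_i := normal_le nu.
have [lt_iz|le_zi] := ltnP i z; last first.
  have := IHu x y z lt_xy lt_yz.
  have := le_i x; have := le_i y; have := le_i z; if_lia.
rewrite (fix_i z lt_iz).
have [lt_iy|le_yi] := ltnP i y; first by rewrite fix_i //; if_lia.
have := normal_mono nu lt_xy.
by have := le_i x; have := le_i y; if_lia.
Qed.

(** Each letter of a run moves the largest point i.+1 past a smaller one. *)
Lemma normal_geodesic N m b u : normal m b u -> m < N -> geodesic N u.
Proof.
move=> nu; elim: nu => {m b u} [m b|m b i j u nu IHu le_ji lt_im lt_jb] lt_mN.
  by rewrite /geodesic /=; apply/eqP; rewrite -leqn0; apply: (card_inversions N [::]).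
have {}IHu : geodesic N u by apply: IHu; lia.
have: j <= i.+1 by lia.
have [d] := ubnP (i.+1 - j); elim: d (j) => // d IHd k lt_d le_k.
have [->|ne_k] := eqVneq k i.+1; first by rewrite block_nil cats0.
rewrite block_rcons -?rcons_cat /geodesic; last by lia.
set s := u ++ _.
have gs : geodesic N s by apply: IHd; lia.
(* x is the point at position k, and i.+1 has reached position k.+1. *)
pose x := track (rev u) k.
have tx : track u x = k by apply: track_rev.
have le_xi : x <= i.
  rewrite leqNgt; apply/negP => lt_ix; have := normal_fix nu lt_ix.
  by rewrite tx; lia.
have ltx : x < N by lia.
have lty : i.+1 < N by lia.
have ascp : ascent s k (Ordinal ltx, Ordinal lty).
  rewrite /ascent /= !track_cat tx (normal_fix nu) // !track_block; if_lia.
by have [pNin ->] := ascent_inversions ascp; rewrite cardsU1 pNin gs size_rcons.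
Qed.

(** The last run can be read off the permutation: i.+1 is the largest point that
    moves, and j is the position where it arrives.  Cancelling the run reduces
    to shorter words. *)
Lemma normal_inj m b u m' b' u' : normal m b u -> normal m' b' u' ->
  track u =1 track u' -> u = u'.
Proof.
move=> nu; elim: nu m' b' u' => {m b u} [m b|m b i j u nu IHu le_ji _ _].
  move=> m' b' u' [|] // {}m' {}b' i j {}u' nu' le_ji _ _ /(_ i.+1).
  by rewrite track_cat (normal_fix nu') // track_block //=; if_lia.
move=> m' b' u' [{}m' {}b' /(_ i.+1)|{}m' {}b' i' j' {}u' nu' le_ji' _ _ eqt].
  by rewrite track_cat (normal_fix nu) // track_block /=; if_lia.
have eq_i : i = i'.
  have [lt_ii|lt_ii|//] := ltngtP i i'.
    have := eqt i'.+1; rewrite !track_cat (normal_fix nu) ?(normal_fix nu') //; last by lia.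
    by rewrite !track_block; if_lia.
  have := eqt i.+1; rewrite !track_cat (normal_fix nu) ?(normal_fix nu') //; last by lia.
  by rewrite !track_block; if_lia.
subst i'.
have eq_j : j = j'.
  have := eqt i.+1; rewrite !track_cat (normal_fix nu) // (normal_fix nu') //.
  by rewrite !track_block; if_lia.
subst j'; congr (_ ++ _); apply: IHu nu' _ => x.
by apply: (@track_inj (block i j)); rewrite -!track_cat eqt.
Qed.

(** * Insertion of letters into normal words *)

Definition apart (i j : nat) : bool := (i.+1 < j) || (j.+1 < i).

(** Commutation of words over all natural numbers; [comm_equiv_lift] brings it
    back to words over a fixed set of generators. *)
Inductive comm_equiv : seq nat -> seq nat -> Prop :=
| CommEquivRefl s : comm_equiv s s
| CommEquivStep s t u i j : apart i j ->
    comm_equiv (s ++ [:: j; i] ++ t) u -> comm_equiv (s ++ [:: i; j] ++ t) u.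

Lemma comm_equiv_trans s t u : comm_equiv s t -> comm_equiv t u -> comm_equiv s u.
Proof.
move=> st; elim: st u => {s t} // s t u i j ij _ IH v /IH.
exact: CommEquivStep.
Qed.

Lemma comm_equiv_sym s t : comm_equiv s t -> comm_equiv t s.
Proof.
elim=> {s t} [s|s t u i j ij _ IH]; first exact: CommEquivRefl.
apply: comm_equiv_trans IH _; apply: CommEquivStep; first by rewrite /apart orbC.
exact: CommEquivRefl.
Qed.

Lemma comm_equiv_cat2l r s t : comm_equiv s t -> comm_equiv (r ++ s) (r ++ t).
Proof.
elim=> {s t} [s|s t u i j ij _ IH]; first exact: CommEquivRefl.
rewrite catA; apply: CommEquivStep ij _; by rewrite -catA.
Qed.

Lemma comm_equiv_cat2r r s t : comm_equiv s t -> comm_equiv (s ++ r) (t ++ r).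
Proof.
elim=> {s t} [s|s t u i j ij _ IH]; first exact: CommEquivRefl.
rewrite -!catA; apply: CommEquivStep ij _; by move: IH; rewrite -!catA.
Qed.

Lemma comm_equiv_letter s c : all (apart c) s -> comm_equiv (s ++ [:: c]) (c :: s).
Proof.
elim: s => [|i s IHs] /=; first by move=> _; apply: CommEquivRefl.
case/andP=> ci cs; apply: comm_equiv_trans (comm_equiv_cat2l [:: i] (IHs cs)) _ => /=.
apply: (@CommEquivStep [::] s _ i c); last exact: CommEquivRefl.
by move: ci; rewrite /apart; lia.
Qed.

Lemma square_or_braid_cat s t r : square_or_braid s -> square_or_braid (t ++ s ++ r).
Proof.
by case=> {s} [s s' i|s s' i j ij]; rewrite -!catA [t ++ _]catA; constructor.
Qed.

Lemma apart_block i j c : c.+1 < j -> all (apart c) (block i j).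
Proof.
move=> lt_cj; apply/allP => x; rewrite mem_rev mem_iota /apart; lia.
Qed.

Lemma block_split i j c : j <= c -> c <= i.+1 ->
  block i j = block i c ++ rev (iota j (c - j)).
Proof.
move=> le_jc le_ci; rewrite /block.
have -> : i.+1 - j = (c - j) + (i.+1 - c) by lia.
by rewrite iotaD rev_cat subnKC.
Qed.

(** A letter c inside the run commutes with everything after c.-1, so that it
    completes the factor c, c.-1, c, or the square jj if c is the last letter. *)
Lemma block_square_or_braid i j c : j <= c -> c <= i ->
  exists2 v, comm_equiv (block i j ++ [:: c]) v & square_or_braid v.
Proof.
move=> le_jc le_ci.
rewrite (@block_split i j c.+1) ?(leqW le_jc) // subSn //.
have -> : rev (iota j (c - j).+1) = c :: rev (iota j (c - j)).
  by rewrite -addn1 iotaD rev_cat /= subnKC.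
have [<-|ne_jc] := eqVneq j c.
  rewrite subnn /= -catA /=; exists (block i j.+1 ++ [:: j; j] ++ [::]).
    exact: CommEquivRefl.
  exact: SquareFactor.
have -> : c - j = (c.-1 - j).+1 by lia.
have -> : rev (iota j (c.-1 - j).+1) = c.-1 :: rev (iota j (c.-1 - j)).
  rewrite -addn1 iotaD rev_cat /= subnKC //; lia.
exists (block i c.+1 ++ [:: c; c.-1; c] ++ rev (iota j (c.-1 - j))).
  rewrite -catA; apply: comm_equiv_cat2l.
  apply: (@comm_equiv_cat2l [:: c; c.-1] (_ ++ [:: c])); apply: comm_equiv_letter.
  apply/allP => x; rewrite mem_rev mem_iota /apart; lia.
by apply: BraidFactor; lia.
Qed.

Lemma normal_weaken m b m' b' u : m <= m' -> b <= b' -> normal m b u -> normal m' b' u.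
Proof.
move=> le_m le_b nu; case: nu le_m le_b => {m b u} [m b|m b i j u nu le_ji lt_im lt_jb] le_m le_b.
  exact: NormalNil.
by apply: NormalBlock => //; lia.
Qed.

(** A letter put to the right of a normal word starts a new run, prolongs the last
    run or commutes past it, unless it completes a factor ii or iji.  In the
    inductive case the letter is smaller than the last letter of the run that
    it passes, so the bounds of that run still hold. *)
Lemma normal_insert m b u c : normal m b u ->
  exists2 v, comm_equiv (u ++ [:: c]) v &
    normal (maxn m c.+1) (maxn b c.+1) v \/ square_or_braid v.
Proof.
have block1 k : block k k = [:: k] by rewrite /block subSnn.
move=> nu; elim: nu c => {m b u} [m b|m b i k u nu IHu le_ki lt_im lt_kb] c.
  exists [:: c]; first exact: CommEquivRefl.
  left; rewrite -[[:: c]]cat0s -block1.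
  by apply: NormalBlock (NormalNil c c) _ _ _; rewrite ?leq_max ?leqnn ?orbT.
(* A letter above the last run forms a run of its own. *)
have [lt_ic|le_ci] := ltnP i c.
  exists ((u ++ block i k) ++ [:: c]); first exact: CommEquivRefl.
  left; rewrite -block1; apply: NormalBlock; try lia.
  by apply: (NormalBlock nu le_ki); lia.
have [le_kc|lt_ck] := leqP k c.
  have [v cv bad_v] := block_square_or_braid le_kc le_ci.
  exists (u ++ v); first by rewrite -catA; apply: comm_equiv_cat2l.
  by right; rewrite -[v]cats0; apply: square_or_braid_cat.
(* The letter c = k.-1 prolongs the last run, unless the previous run ends in c
   too: then c, k, c become adjacent. *)
have [eq_ck|ne_ck] := eqVneq c.+1 k.
  have [nu'|[i' [u' [lt_ii le_ci' eq_u]]]] : normal i c u \/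
      exists i' u', [/\ i' < i, c <= i' & u = u' ++ block i' c].
    case: nu eq_ck {IHu} => [m' b'|m' b' i' j' u' nu' le_ji' lt_im' lt_jb'] eq_ck.
      by left; apply: NormalNil.
    have [lt_jc|ge_jc] := ltnP j' c; first by left; apply: NormalBlock.
    have -> : c = j' by lia.
    by right; exists i', u'.
  - exists (u ++ block i c).
      rewrite (@block_rcons i c) // -cats1 eq_ck -catA; exact: CommEquivRefl.
    by left; apply: (NormalBlock nu'); lia.
  exists ((u' ++ block i' c.+1 ++ block i k.+1) ++ [:: c; k; c] ++ [::]).
    rewrite eq_u (block_rcons le_ki) (block_rcons le_ci') -!cats1 -!catA.
    do 2!apply: comm_equiv_cat2l.
    have : comm_equiv ([:: c] ++ block i k.+1) (block i k.+1 ++ [:: c]).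
      by apply/comm_equiv_sym/comm_equiv_letter/apart_block; lia.
    by move/(comm_equiv_cat2r [:: k; c]); rewrite -!catA.
  by right; apply: BraidFactor; lia.
have [v cv nv] := IHu c.
exists (v ++ block i k).
  rewrite -catA; apply: comm_equiv_trans (comm_equiv_cat2r _ cv); rewrite -catA.
  apply/comm_equiv_cat2l/comm_equiv_letter/apart_block; lia.
case: nv => [nv|bad_v]; last by right; apply: (@square_or_braid_cat v [::]).
left; apply: (@NormalBlock _ _ i k) => //; try lia.
by apply: normal_weaken nv; lia.
Qed.

Lemma normal_or_square_or_braid n s : all (gtn n) s ->
  exists2 v, comm_equiv s v & normal n n v \/ square_or_braid v.
Proof.
elim/last_ind: s => [_|s c IHs].
  by exists [::]; [apply: CommEquivRefl|left; apply: NormalNil].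
rewrite all_rcons => /andP[/= lt_cn /IHs[v sv [nv|bad_v]]]; last first.
  exists (v ++ [:: c]); first by rewrite -cats1; apply: comm_equiv_cat2r.
  by right; apply: (@square_or_braid_cat v [::]).
have [w vw nw] := normal_insert c nv.
exists w; first by rewrite -cats1; apply: comm_equiv_trans (comm_equiv_cat2r _ sv) vw.
by case: nw => [nw|]; [left; apply: normal_weaken nw; lia|right].
Qed.

(** * Fully commutative elements are the normal words *)

Lemma map_eq_cat (T T' : Type) (f : T -> T') s a b : map f s = a ++ b ->
  exists s1 s2, [/\ s = s1 ++ s2, map f s1 = a & map f s2 = b].
Proof.
move=> eq_s; exists (take (size a) s), (drop (size a) s).
by rewrite cat_take_drop map_take map_drop eq_s take_size_cat ?drop_size_cat.
Qed.

Lemma comm_equiv_lift n (s : seq 'I_n) t : comm_equiv (map val s) t ->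
  exists2 t' : seq 'I_n, t = map val t' & clos_refl_trans _ (@comm_step n) s t'.
Proof.
move eq_s: (map val s) => s0 st; elim: st s eq_s => {s0 t} [_ s <-|a b u i j ij _ IH s eq_s].
  by exists s; last exact: rt_refl.
have [a' [sb [es ea /map_eq_cat[ij' [b' [esb eij eb]]]]]] := map_eq_cat eq_s.
case: ij' eij esb => [|i' [|j' []]] //= [ei ej] esb; subst sb.
have [|t' -> st'] := IH (a' ++ [:: j'; i'] ++ b').
  by rewrite !map_cat /= ea eb ei ej.
exists t' => //; apply: rt_trans st'; rewrite es; apply: rt_step.
by apply: CommStep; rewrite -ei -ej in ij.
Qed.

Lemma comm_step_sym n (s t : seq 'I_n) :
  clos_refl_trans _ (@comm_step n) s t -> clos_refl_trans _ (@comm_step n) t s.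
Proof.
elim=> {s t} [s t [a b i j ij]|s|s t u _ IH1 _ IH2].
- by apply: rt_step; apply: CommStep; rewrite orbC.
- exact: rt_refl.
- exact: rt_trans IH2 IH1.
Qed.

Lemma comm_steps_cox_eq n (s t : seq 'I_n) :
  clos_refl_trans _ (@comm_step n) s t -> cox_eq s t.
Proof.
elim=> {s t} [s t [a b i j ij]|s|s t u _ IH1 _ IH2].
- apply: CoxCat; first exact: CoxRefl.
  by apply: CoxCat; [apply: CoxComm|apply: CoxRefl].
- exact: CoxRefl.
- exact: CoxTrans IH1 IH2.
Qed.

Lemma comm_steps_perm n (s t : seq 'I_n) :
  clos_refl_trans _ (@comm_step n) s t -> perm_eq s t.
Proof.
elim=> {s t} [s t [a b i j ij]|s|s t u _ IH1 _ IH2].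
- by rewrite perm_cat2l perm_cat2r (perm_catC [:: i] [:: j]).
- exact: perm_refl.
- exact: perm_trans IH1 IH2.
Qed.

Lemma cox_length_le n (w : cox_group n) s : cox_prod s = w -> cox_length w <= size s.
Proof.
move=> <-; rewrite /cox_length; case: ex_minnP => k _; apply.
by apply/existsP; exists (in_tuple s).
Qed.

Lemma reduced_exists n (w : cox_group n) : exists s, reduced w s.
Proof.
have : [exists s : (cox_length w).-tuple 'I_n, cox_prod s == w].
  by rewrite /cox_length; case: ex_minnP.
by case/existsP => s /eqP ws; exists s; split; rewrite ?size_tuple.
Qed.

Lemma word_all n (s : seq 'I_n) : all (gtn n) (map val s).
Proof. by apply/allP => _ /mapP[i _ ->] /=. Qed.

Section NormalWord.
Variables (n : nat) (u : seq 'I_n).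
Hypothesis nu : normal n n (map val u).

Lemma normal_geodesic_word : #|inversions n.+1 (map val u)| = size u.
Proof. by rewrite (normal_geodesic nu) ?size_map. Qed.

Lemma inversions_cox (s t : seq 'I_n) : cox_eq s t ->
  inversions n.+1 (map val s) = inversions n.+1 (map val t).
Proof. by move/track_cox_eq => st; apply/setP => p; rewrite !inE !st. Qed.

Lemma cox_length_normal : cox_length (cox_prod u) = size u.
Proof.
apply/eqP; rewrite eqn_leq cox_length_le //=.
have [s [/cox_prod_eq/inversions_cox eq_s <-]] := reduced_exists (cox_prod u).
by rewrite -normal_geodesic_word -eq_s -(size_map val s) card_inversions.
Qed.

(** A reduced word of the same element is as long as u and has the same
    permutation, so it is geodesic and avoids 321.  Insertion thus produces a
    normal word from it, and that word is u since the permutations agree. *)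
Lemma reduced_commute s : reduced (cox_prod u) s ->
  clos_refl_trans _ (@comm_step n) s u.
Proof.
move=> [/cox_prod_eq su]; rewrite cox_length_normal => size_s.
have [v sv nv] := normal_or_square_or_braid (word_all s).
have [t eq_v st] := comm_equiv_lift sv; subst v.
have tu : cox_eq t u by apply: CoxTrans su; apply/CoxSym/comm_steps_cox_eq.
have eq_size : size t = size u by rewrite -size_s (perm_size (comm_steps_perm st)).
case: nv => [nt|bad_t].
  suff -> : u = t by [].
  apply/(inj_map val_inj)/(normal_inj nu nt)/track_cox_eq; exact: CoxSym.
case: (@geodesic_avoids321 n.+1 _ _ _ bad_t).
  by rewrite /geodesic (inversions_cox tu) normal_geodesic_word size_map.
move=> x y z xy yz; rewrite !(track_cox_eq tu); exact: normal_avoids321 nu _ _ _ xy yz.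
Qed.

Lemma normal_fully_commutative : fully_commutative n (cox_prod u).
Proof.
move=> s t /reduced_commute su /reduced_commute tu.
by apply: rt_trans su (comm_step_sym tu).
Qed.

End NormalWord.

(** A factor ii contradicts minimal length.  A factor iji can be replaced by jij in
    another reduced word with a different number of letters i, which no sequence
    of commutations produces. *)
Lemma fully_commutative_normal n (w : cox_group n) : fully_commutative n w ->
  exists2 u : seq 'I_n, normal n n (map val u) & cox_prod u = w.
Proof.
move=> fc_w; have [s rs] := reduced_exists w.
have [v sv nv] := normal_or_square_or_braid (word_all s).
have [t eq_v st] := comm_equiv_lift sv; subst v.
have rt : reduced w t.
  case: rs => ws size_s; split.
    by rewrite -ws; apply/cox_prod_eq/CoxSym/comm_steps_cox_eq.
  by rewrite -size_s (perm_size (comm_steps_perm st)).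
case: nv => [nt|bad_t]; first by exists t => //; case: rt.
have [wt size_t] := rt.
move eq_t0: (map val t) bad_t => t0 bad_t; case: bad_t eq_t0 => {t0} a b i.
  move=> /map_eq_cat[a' [tb [et _ /map_eq_cat[ij [b' [etb eij _]]]]]].
  case: ij eij etb => [|x [|y []]] //= [<- /val_inj exy] etb; subst tb y.
  have : cox_prod (a' ++ b') = w.
    rewrite -wt et; apply/cox_prod_eq/CoxCat; first exact: CoxRefl.
    apply: (@CoxCat _ [::] [:: x; x] b' b'); last exact: CoxRefl.
    exact/CoxSym/CoxSqr.
  by move/cox_length_le; rewrite -size_t et !size_cat /=; lia.
move=> j ij /map_eq_cat[a' [tb [et _ /map_eq_cat[ijk [b' [etb eij _]]]]]].
case: ijk eij etb => [|x [|y [|z []]]] //= [ex ey ez] etb; subst tb.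
have /val_inj ezx : z = x :> nat by rewrite ez ex.
subst z; have xy : cox_eq [:: x; y; x] [:: y; x; y].
  case/orP: ij => /eqP ij; last apply: CoxSym; apply: CoxBraid;
    by rewrite ex ey.
have rt' : reduced w (a' ++ [:: y; x; y] ++ b').
  split; last by rewrite -size_t et !size_cat.
  rewrite -wt et; apply/cox_prod_eq/CoxCat; first exact: CoxRefl.
  apply: (@CoxCat _ [:: y; x; y] [:: x; y; x] b' b'); last exact: CoxRefl.
  exact: CoxSym.
have /comm_steps_perm := fc_w _ _ rt rt'.
(* The number of letters x distinguishes the two reduced words. *)
have neq_xy : x != y by rewrite -val_eqE /= ex ey; lia.
rewrite et perm_cat2l (perm_cat2r b' [:: x; y; x] [:: y; x; y]).
by move/permP/(_ (pred1 x)); rewrite /= eqxx eq_sym (negPf neq_xy).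
Qed.

(** * The generating function of normal words *)

Fixpoint normal_words (m b : nat) : seq (seq nat) :=
  if m is m'.+1 then
    normal_words m' b ++
    [seq u ++ block m' k | k <- iota 0 (minn b m), u <- normal_words m' k]
  else [:: [::]].

Lemma normal_wordsP m b u : reflect (normal m b u) (u \in normal_words m b).
Proof.
apply: (iffP idP) => [|nu].
  elim: m b u => [|m IHm] b u /=.
    by rewrite inE => /eqP->; apply: NormalNil.
  rewrite mem_cat => /orP[/IHm nu|/allpairsPdep[k [v [lt_k /IHm nv ->]]]].
    by apply: normal_weaken nu.
  by move: lt_k; rewrite mem_iota => lt_k; apply: (NormalBlock nv); lia.
elim: nu => {m b u} [m b|m b i j u nu IHu le_ji lt_im lt_jb].
  by elim: m => //= m IHm; rewrite mem_cat IHm.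
elim: m lt_im => // m IHm lt_im; rewrite /= mem_cat.
have [lt_im'|le_mi] := ltnP i m; first by rewrite IHm.
have eq_im : i = m by lia.
subst m; apply/orP; right; apply/allpairsPdep; exists j, u; split=> //.
by rewrite mem_iota; lia.
Qed.

Lemma normal_words_uniq m b : uniq (normal_words m b).
Proof.
elim: m b => //= m IHm b; rewrite cat_uniq IHm /=; apply/andP; split.
  apply/hasPn => _ /allpairsPdep[k [u [lt_k /normal_wordsP nu ->]]].
  apply/negP => /normal_wordsP /normal_fix/(_ (ltnSn m)).
  rewrite mem_iota in lt_k.
  by rewrite track_cat (normal_fix nu) // track_block ?eqxx; lia.
apply: allpairs_uniq_dep => [|k _|]; [exact: iota_uniq|exact: IHm|].
move=> p p' /allpairsPdep[k [u [lt_k /normal_wordsP nu ->]]].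
move=> /allpairsPdep[k' [u' [lt_k' /normal_wordsP nu' ->]]] /= eq_uu.
rewrite !mem_iota in lt_k lt_k'.
have eq_kk : k = k'.
  have : track (u ++ block m k) m.+1 = track (u' ++ block m k') m.+1 by rewrite eq_uu.
  rewrite !track_cat (normal_fix nu) // (normal_fix nu') // !track_block ?eqxx; lia.
subst k'; have eq_size : size u = size u'.
  by have /(congr1 size) := eq_uu; rewrite !size_cat => /addIn.
by move/eqP: eq_uu; rewrite eqseq_cat // eqxx andbT => /eqP->.
Qed.

Lemma normal_letters m b u : normal m b u -> all (gtn m) u.
Proof.
elim=> {m b u} // m b i j u _ IHu le_ji lt_im _.
rewrite all_cat; apply/andP; split.
  by apply: sub_all IHu => x /=; lia.
by apply/allP => x; rewrite mem_rev mem_iota /=; lia.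
Qed.

Local Open Scope ring_scope.

Definition normal_gf (m b : nat) : {poly int} :=
  \sum_(u <- normal_words m b) 'X^(size u).

Lemma fc_poincare_normal_gf n : (0 < n)%N -> fc_poincare n = normal_gf n n.
Proof.
case: n => // n _; pose word (u : seq nat) : seq 'I_n.+1 := map inord u.
have wordK u : normal n.+1 n.+1 u -> map val (word u) = u.
  move/normal_letters/allP=> lt_u; rewrite -map_comp -[RHS]map_id.
  by apply/eq_in_map => x /lt_u /=; rewrite ltnS => le_xn; rewrite inordK.
pose elts := [seq cox_prod (word u) | u <- normal_words n.+1 n.+1].
have elts_uniq : uniq elts.
  rewrite map_inj_in_uniq ?normal_words_uniq // => u v.
  move=> /normal_wordsP nu /normal_wordsP nv /cox_prod_eq/track_cox_eq.
  by rewrite !wordK //; apply: normal_inj nu nv.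
have eltsE : fully_commutative n.+1 = [set` elts]%classic.
  apply/seteqP; split=> [w /fully_commutative_normal[u nu <-]|w] /=.
    apply/mapP; exists (map val u); first exact/normal_wordsP.
    by congr cox_prod; apply: (inj_map val_inj); rewrite wordK.
  move=> /mapP[u /normal_wordsP nu ->].
  by apply: normal_fully_commutative; rewrite wordK.
rewrite /fc_poincare eltsE -fsbig_seq // big_map /normal_gf.
apply: eq_big_seq => u /normal_wordsP nu.
by rewrite cox_length_normal ?wordK // size_map.
Qed.

Lemma normal_gf_rec m b : normal_gf m.+1 b =
  normal_gf m b + \sum_(k < minn b m.+1) 'X^(m.+1 - k) * normal_gf m k.
Proof.
rewrite /normal_gf /= big_cat /=; congr (_ + _).
rewrite big_allpairs_dep /=.
have -> : iota 0 (minn b m.+1) = index_iota 0 (minn b m.+1).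
  by rewrite /index_iota subn0.
rewrite big_mkord; apply: eq_bigr => k _; rewrite big_distrr /=.
by apply: eq_bigr => u _; rewrite size_cat size_block addnC exprD.
Qed.

Lemma normal_gf0 m : normal_gf m 0 = 1.
Proof.
elim: m => [|m IHm]; first by rewrite /normal_gf big_seq1.
by rewrite normal_gf_rec IHm min0n big_ord0 addr0.
Qed.

Lemma normal_gf_stable m b : (m <= b)%N -> normal_gf m b = normal_gf m m.
Proof.
elim: m b => // m IHm b lt_mb; rewrite !normal_gf_rec.
by rewrite minnn (minn_idPr lt_mb) !(IHm _ (ltnW _)).
Qed.

(** Raising the bound from b to b.+1 only adds the words whose last run ends in b;
    those among them that use the letter m consist of a word counted by
    [normal_gf m b] followed by the run from m to b. *)
Lemma normal_gf_step m b : (b <= m)%N ->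
  normal_gf m.+1 b.+1 - normal_gf m.+1 b =
  normal_gf m b.+1 - normal_gf m b + 'X^(m.+1 - b) * normal_gf m b.
Proof.
move=> le_bm; rewrite !normal_gf_rec (minn_idPl _) ?ltnS //.
rewrite (minn_idPl (leqW le_bm)) big_ord_recr /=; ring.
Qed.

Lemma normal_gf1 m : normal_gf m 1 = 1 + \sum_(1 <= j < m.+1) 'X^j.
Proof.
elim: m => [|m IHm]; first by rewrite /normal_gf big_seq1 big_nil addr0.
rewrite normal_gf_rec IHm (minn_idPl _) // big_ord1 normal_gf0 mulr1.
by rewrite [in RHS]big_nat_recr //= subn0 addrA.
Qed.

(** * Placements of blocks as recursive sums *)

Lemma sum_tuple0 (V : nmodType) m (P : pred (seq nat)) (F : seq nat -> V) :
  \sum_(t : 0.-tuple 'I_m | P (nat_vals t)) F (nat_vals t) =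
  if P [::] then F [::] else 0.
Proof.
rewrite big_mkcond (big_pred1 [tuple]) // => t.
by rewrite [t]tuple0 /= eqxx.
Qed.

Lemma sum_tupleS (V : nmodType) m k (P : pred (seq nat)) (F : seq nat -> V) :
  \sum_(t : k.+1.-tuple 'I_m | P (nat_vals t)) F (nat_vals t) =
  \sum_(x < m) \sum_(t : k.-tuple 'I_m | P (val x :: nat_vals t))
     F (val x :: nat_vals t).
Proof.
rewrite pair_big_dep /=.
rewrite (reindex (fun p : 'I_m * k.-tuple 'I_m => [tuple of p.1 :: p.2])) //=.
exists (fun t : k.+1.-tuple 'I_m => (thead t, [tuple of behead t])) => [[x t] _|t _].
  by congr (_, _) => //; apply/val_inj.
by rewrite [RHS]tuple_eta; apply/val_inj.
Qed.

(** The admissibility condition, read from left to right: once the first block is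
    placed, the others are placed in the interval that starts after it. *)
Fixpoint placed (a b : nat) (l i : seq nat) : bool :=
  match l, i with
  | x :: l', y :: i' => (a <= y)%N && placed (y + x) b l' i'
  | _, _ => (a <= b.+1)%N
  end.

Lemma forall_ordS n (P : nat -> bool) :
  [forall t : 'I_n.+1, P t] = P 0%N && [forall t : 'I_n, P t.+1].
Proof.
apply/forallP/andP => [allP|[P0 /forallP allP] [[|t] lt_t]] //.
  by split; [apply: (allP ord0)|apply/forallP => t; apply: (allP (lift ord0 t))].
exact: (allP (Ordinal (lt_t : (t < n)%N))).
Qed.

Lemma block_admissibleE a b x l y i : size l = size i ->
  block_admissible a b (x :: l) (y :: i) = placed a b (x :: l) (y :: i).
Proof.
elim: l i a x y => [|x' l IHl] [|y' i] //= a x y.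
  rewrite /block_admissible /=; case: (a <= y)%N => //=.
  by case: forallP => //= -[] [].
case=> eq_size; have /= <- := IHl i (y + x)%N x' y' eq_size.
rewrite /block_admissible /= (forall_ordS _ (fun t => nth 0 (y :: y' :: i) t +
  nth 0 (x :: x' :: l) t <= nth 0 (y :: y' :: i) t.+1)%N) /=.
by rewrite -!andbA.
Qed.

Lemma placed_le a b l i : size l = size i -> placed a b l i ->
  (a + sumn l <= b.+1)%N.
Proof.
elim: l i a => [|x l IHl] [|y i] //= a; first by rewrite addn0.
by case=> eq_size /andP[le_ay /(IHl _ _ eq_size)]; lia.
Qed.

Lemma in_block_cons x l y i j :
  in_block (x :: l) (y :: i) j = (y <= j < y + x)%N || in_block l i j.
Proof.
apply/existsP/orP => [[[[|t] lt_t] /= jt]|[jy|/existsP[t jt]]].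
- by left.
- by right; apply/existsP; exists (Ordinal (lt_t : (t < size l)%N)).
- by exists ord0.
- by exists (lift ord0 t).
Qed.

Lemma placed_in_block a b l i j : size l = size i -> placed a b l i ->
  in_block l i j -> (a <= j)%N.
Proof.
elim: l i a => [|x l IHl] [|y i] // a.
  by move=> _ _ /existsP[[]].
case=> eq_size /= /andP[le_ay pl]; rewrite in_block_cons => /orP[|].
  by lia.
by move/(IHl _ _ eq_size pl); lia.
Qed.

Lemma Pi_blocks_nil a b : Pi_blocks a b [::] [::] = Pi a b.
Proof.
rewrite /Pi_blocks /= big_ord0 mulr1 /Pi; apply: eq_bigl => j.
by apply/negP => /existsP[[]].
Qed.

Lemma Pi_blocks_cons a b x l y i : size l = size i ->
  placed a b (x :: l) (y :: i) ->
  Pi_blocks a b (x :: l) (y :: i) =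
  (\prod_(a <= j < y) (1 - 'X^j)) * - 'X^y * Pi_blocks (y + x) b l i.
Proof.
move=> eq_size /= /andP[le_ay pl].
have le_b := placed_le eq_size pl.
rewrite /Pi_blocks big_ord_recl /= -!mulrA.
rewrite (@big_cat_nat _ _ _ y) //=; last by lia.
rewrite (@big_cat_nat _ _ _ (y + x) y) //=; [|lia|lia].
rewrite [X in _ * (X * _) * _]big_nat_cond [X in _ * (X * _) * _]big_pred0; last first.
  by move=> j; rewrite in_block_cons; case: (y <= j < y + x)%N.
have -> : \prod_(a <= j < y | ~~ in_block (x :: l) (y :: i) j) (1 - 'X^j) =
          \prod_(a <= j < y) (1 - 'X^j) :> {poly int}.
  rewrite big_nat_cond [RHS]big_nat_cond; apply: eq_bigl => j.
  rewrite in_block_cons; have := @placed_in_block (y + x) b l i j eq_size pl.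
  by case: in_block => [/(_ isT)|_]; lia.
have -> : \prod_(y + x <= j < b.+1 | ~~ in_block (x :: l) (y :: i) j) (1 - 'X^j) =
          \prod_(y + x <= j < b.+1 | ~~ in_block l i j) (1 - 'X^j) :> {poly int}.
  rewrite big_nat_cond [RHS]big_nat_cond; apply: eq_bigl => j.
  by rewrite in_block_cons; lia.
ring.
Qed.

Definition block_sum (b a : nat) (l : seq nat) : {poly int} :=
  \sum_(i : (size l).-tuple 'I_b.+1 | placed a b l (nat_vals i))
     Pi_blocks a b l (nat_vals i).

Lemma size_nat_vals m k (t : k.-tuple 'I_m) : size (nat_vals t) = k.
Proof. by rewrite size_map size_tuple. Qed.

Lemma SigmaPiE a b x l : SigmaPi a b (x :: l) = block_sum b a (x :: l).
Proof.
apply: eq_bigl => i; have := size_nat_vals i.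
case: (nat_vals i) => [|y s] //= [] size_s; exact: block_admissibleE.
Qed.

Lemma block_sum_nil b a : block_sum b a [::] = if (a <= b.+1)%N then Pi a b else 0.
Proof. by rewrite /block_sum (sum_tuple0 _ (placed a b [::])) Pi_blocks_nil. Qed.

Lemma block_sum_cons b a x l : block_sum b a (x :: l) =
  \sum_(a <= y < b.+1) (\prod_(a <= j < y) (1 - 'X^j)) * - 'X^y * block_sum b (y + x) l.
Proof.
rewrite /block_sum /= (sum_tupleS _ _ (placed a b (x :: l))) /=.
have [lt_ba|le_ab] := ltnP b a.
  rewrite big_geq // big1 // => y _; rewrite big_pred0 // => i.
  by rewrite leqNgt (leq_trans (ltn_ord y)).
rewrite -(@big_mkord _ _ _ b.+1 predT (fun y => \sum_(t : (size l).-tuple 'I_b.+1 |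
   (a <= y)%N && placed (y + x) b l (nat_vals t))
     Pi_blocks a b (x :: l) (y :: nat_vals t))).
rewrite (@big_cat_nat _ _ _ a) //=; last by lia.
rewrite big1_seq ?add0r; last first.
  by move=> y; rewrite mem_index_iota => lt_y; rewrite big_pred0 // => i; lia.
apply: eq_big_nat => y /andP[le_ay _].
rewrite big_distrr /=; apply: eq_big => [i|i pl]; first by rewrite le_ay.
by rewrite Pi_blocks_cons // size_nat_vals.
Qed.

Lemma block_sum_out b a l : (b < a)%N -> block_sum b a l = ((l == [::]) && (a == b.+1))%:R.
Proof.
case: l => [|x l] lt_ba; last by rewrite block_sum_cons big_geq.
rewrite block_sum_nil /Pi; case: ltngtP => // [|eq_a]; first by lia.
by rewrite big_geq ?eq_a.
Qed.

Lemma block_sum_nil_step b a : (a <= b)%N ->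
  block_sum b a [::] = (1 - 'X^a) * block_sum b a.+1 [::].
Proof.
move=> le_ab; rewrite !block_sum_nil ltnS le_ab (leqW le_ab) /Pi.
by rewrite big_ltn // ltnS.
Qed.

(** The point a is either a single factor or the start of the first block. *)
Lemma block_sum_step b a x l : (a <= b)%N ->
  block_sum b a (x :: l) = (1 - 'X^a) * block_sum b a.+1 (x :: l)
    - 'X^a * block_sum b (a + x) l.
Proof.
move=> le_ab; rewrite !block_sum_cons big_ltn ?ltnS // big_geq // mul1r.
rewrite addrC mulNr; congr (_ - _); rewrite big_distrr /=.
by apply: eq_big_nat => y /andP[lt_ay _]; rewrite [in LHS]big_ltn // !mulrA.
Qed.

Lemma block_sum_large b a l : (b.+1 < a + sumn l)%N -> block_sum b a l = 0.
Proof.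
move=> lt_b; rewrite /block_sum big_pred0 // => i; apply/negP => pl.
have := placed_le _ pl; rewrite size_nat_vals => /(_ erefl); lia.
Qed.

(** * Sums over compositions: tilings of an interval *)

Fixpoint compositions (r k : nat) : seq (seq nat) :=
  if r is r'.+1 then
    [seq x :: d | x <- iota 1 k, d <- compositions r' (k - x)]
  else if k == 0%N then [:: [::]] else [::].

Lemma sum_compositions (V : nmodType) m r k (F : seq nat -> V) : (k <= m)%N ->
  \sum_(d : r.-tuple 'I_m.+1 | is_composition k (nat_vals d)) F (nat_vals d) =
  \sum_(d <- compositions r k) F d.
Proof.
elim: r k F => [|r IHr] k F le_km /=.
  rewrite (sum_tuple0 _ (is_composition k)) /is_composition /= eq_sym.
  by case: eqP => _; rewrite ?big_seq1 ?big_nil.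
rewrite (sum_tupleS _ _ (is_composition k)) big_allpairs_dep /=.
rewrite -(@big_mkord _ _ _ m.+1 predT (fun x => \sum_(t : r.-tuple 'I_m.+1 |
   is_composition k (x :: nat_vals t)) F (x :: nat_vals t))).
rewrite (@big_cat_nat _ _ _ k.+1) //= [X in _ + X]big1_seq ?addr0; last first.
  move=> x; rewrite mem_index_iota => lt_x; rewrite big_pred0 // => i.
  by rewrite /is_composition /=; lia.
rewrite big_ltn // big_pred0 ?add0r //.
have -> : iota 1 k = index_iota 1 k.+1 by rewrite /index_iota subn1.
apply: eq_big_nat => x /andP[lt0x le_xk].
rewrite -(IHr _ (fun d => F (x :: d))); last by lia.
apply: eq_bigl => i; rewrite /is_composition /= lt0x /=; congr (_ && _).
by lia.
Qed.

Lemma compositionsP r k d : d \in compositions r k -> size d = r /\ sumn d = k /\ (r <= k)%N.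
Proof.
elim: r k d => [|r IHr] k d /=.
  by case: eqP => [->|] //; rewrite inE => /eqP->.
move=> /allpairsPdep[x [d' [lt_x /IHr[size_d [sum_d le_r]] ->]]].
by move: lt_x; rewrite mem_iota /= size_d sum_d; lia.
Qed.

Lemma sumn_mapS d : sumn [seq x.+1 | x <- d] = (sumn d + size d)%N.
Proof. by elim: d => //= x d ->; lia. Qed.

Definition tiling_part b r a k : {poly int} :=
  \sum_(d <- compositions r k) block_sum b a [seq x.+1 | x <- d].

(** The parameter k is the sum of the block lengths minus one, and r is the number
    of blocks; every block contributes at least one to k, whence the range
    of r. *)
Definition tilings (b a k : nat) : {poly int} :=
  \sum_(0 <= r < k.+1) tiling_part b r a k.

Lemma tiling_part_gt b r a k : (k < r)%N -> tiling_part b r a k = 0.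
Proof.
move=> lt_kr; rewrite /tiling_part big1_seq // => d /andP[_ /compositionsP[_ [_]]].
by lia.
Qed.

Lemma tiling_part_large b r a k : (b.+1 < a + k + r)%N -> tiling_part b r a k = 0.
Proof.
move=> lt_b; rewrite /tiling_part big1_seq // => d /andP[_ /compositionsP[size_d [sum_d _]]].
by rewrite block_sum_large // sumn_mapS size_d sum_d; lia.
Qed.

Lemma tilings_widen b a k R : (k < R)%N ->
  tilings b a k = \sum_(0 <= r < R) tiling_part b r a k.
Proof.
move=> lt_kR; rewrite [RHS](@big_cat_nat _ _ _ k.+1) //=.
rewrite [X in _ + X]big1_seq ?addr0 // => r; rewrite mem_index_iota => /andP[_ /andP[lt_kr _]].
exact: tiling_part_gt.
Qed.

Lemma tilings_large b a k : (0 < k)%N -> (b < a + k)%N -> tilings b a k = 0.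
Proof.
move=> lt0k lt_b; rewrite /tilings big1_seq // => r _.
case: r => [|r]; last by apply: tiling_part_large; lia.
by rewrite /tiling_part /=; case: eqP lt0k => [->|_] //; rewrite big_nil.
Qed.

Lemma tiling_part0 b a k : tiling_part b 0 a k = if k == 0%N then block_sum b a [::] else 0.
Proof. by rewrite /tiling_part /=; case: eqP => _; rewrite ?big_seq1 ?big_nil. Qed.

Lemma tilings_out b a k : (b < a)%N -> tilings b a k = ((k == 0%N) && (a == b.+1))%:R.
Proof.
move=> lt_ba; case: k => [|k]; last by rewrite tilings_large //; lia.
by rewrite /tilings big_nat1 tiling_part0 /= block_sum_out.
Qed.

Lemma tilings_step b a k : (a <= b)%N -> tilings b a k =
  (1 - 'X^a) * tilings b a.+1 k
  - 'X^a * \sum_(1 <= x < k.+1) tilings b (a + x.+1) (k - x).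
Proof.
move=> le_ab; rewrite /tilings !(big_nat_recl _ _ _ (leq0n k)) /=.
rewrite mulrDr -addrA; congr (_ + _).
  by rewrite !tiling_part0; case: eqP; rewrite ?mulr0 // block_sum_nil_step.
have stepS r : tiling_part b r.+1 a k = (1 - 'X^a) * tiling_part b r.+1 a.+1 k -
    'X^a * \sum_(1 <= x < k.+1) tiling_part b r (a + x.+1) (k - x).
  rewrite /tiling_part /= !big_allpairs_dep /=.
  have -> : iota 1 k = index_iota 1 k.+1 by rewrite /index_iota subn1.
  rewrite !big_distrr -sumrB; apply: eq_bigr => x _.
  rewrite !big_distrr -sumrB; apply: eq_bigr => d _ /=.
  by rewrite block_sum_step.
rewrite (eq_bigr _ (fun r _ => stepS r)) sumrB -!big_distrr /=; congr (_ - _ * _).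
rewrite exchange_big /=; apply: eq_big_nat => x /andP[lt0x lt_xk].
by rewrite -/(tilings b (a + x.+1) (k - x)) (@tilings_widen _ _ _ k) //; lia.
Qed.

(** Let H(a, k) be the sum over the length of a block that starts at a.  Its first
    term removed, H(a, k.+1) becomes H(a.+1, k), which the recurrence at a.+1
    expresses through [tilings].  The weights 'X^a and 'X^(a.+1) of the two
    blocks differ by a factor 'X; multiplication by 'X^k absorbs it. *)
Lemma tilings_three_term b a k : (a < b)%N ->
  'X^(k.+1) * tilings b a k.+1 = (1 - 'X^a) * ('X^(k.+1) * tilings b a.+1 k.+1)
    + 'X^k * tilings b a.+1 k - 'X^k * tilings b a.+2 k.
Proof.
move=> lt_ab; rewrite (tilings_step _ (ltnW lt_ab)) big_ltn // subSS subn0.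
rewrite big_add1 /=.
have eqS : \sum_(1 <= x < k.+1) tilings b (a + x.+2) (k.+1 - x.+1) =
   \sum_(1 <= x < k.+1) tilings b (a.+1 + x.+1) (k - x).
  by apply: eq_big_nat => x _; rewrite subSS addnS.
have := tilings_step k lt_ab; rewrite -eqS addn2.
set S := \sum_(_ <= _ < _) _ => ->.
rewrite !exprS; ring.
Qed.

Lemma tilings_last b k : tilings b b k = if k == 0%N then 1 - 'X^b else 0.
Proof.
case: k => [|k]; last by rewrite tilings_large //; lia.
by rewrite tilings_step // big_geq // mulr0 subr0 tilings_out // !eqxx mulr1.
Qed.

(** * The unitriangular system *)

(** The recurrences satisfied by [tiling_value] below, with f in the role of
    [psi]. *)
Section Telescope.
Variables (R : comNzRingType) (q : R) (m : nat) (V : nat -> nat -> nat -> R).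
Hypothesis VE : forall k j a, (a <= m)%N -> V k j a =
  (1 - q ^+ a) * V k j a.+1 + V k j.+1 a.+1 - V k j.+1 a.+2.
Hypothesis V_last : forall k j, V k j m.+2 = V k j m.+1.
Hypothesis V_row0 : forall j a, V 0%N j.+1 a - V 1%N j a = q * V 0%N j a.
Hypothesis V_row : forall k j a, V k.+1 j.+1 a - V k.+2 j a =
  V k j.+1 a - V k.+1 j a + q ^+ k.+2 * V k.+1 j a.

(** The difference V k 1 k.+3 - V k.+1 0 k.+2 does not depend on k: expanding its
    second term by the recurrence in a and the result by the recurrence in k
    gives the same expression for k.+1. *)
Lemma telescope_rows : (0 < m)%N ->
  V 0%N 0%N 2 - V 0%N 0%N 1 = V m.-1 1%N m.+1 - V m 0%N m.+1.
Proof.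
move=> lt0m; rewrite -V_last.
have -> : V 0%N 0%N 2 - V 0%N 0%N 1 = V 0%N 1%N 3 - V 1%N 0%N 2.
  by rewrite (@VE 0%N 0%N 1) // expr1; have := V_row0 0 2; move/(canRL (subrK _))=> ->; ring.
have inv k : (k < m)%N -> V 0%N 1%N 3 - V 1%N 0%N 2 = V k 1%N k.+3 - V k.+1 0%N k.+2.
  elim: k => // k IHk lt_km; rewrite (IHk (ltnW lt_km)) (@VE k.+1 0%N k.+2) //.
  by have := V_row k 0 k.+3; move/(canRL (subrK _))=> ->; ring.
have lt_mm : (m.-1 < m)%N by lia.
by rewrite (inv _ lt_mm) (prednK lt0m) V_last.
Qed.

Variable f : nat -> R.
Hypothesis f0 : f 0%N = 0.
Hypothesis fS : forall t, f t.+1 = f t + q ^+ t.+2.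

(** With D u = V 0 u u.+3 - V 0 u u.+2 and E u = V 0 u u.+2 - V 0 u u.+1, the
    recurrence in a reads q^(u+2) V 0 u u.+3 = D u - D u.+1 at a = u.+2 and
    q^(u+1) V 0 u u.+2 = E u - E u.+1 at a = u.+1.  Hence the sum is
    f s * D s + q * (E 0 - E s) by Abel summation. *)
Lemma telescope_columns s : (s < m)%N ->
  \sum_(0 <= u < s) (1 - f u.+1) * (q ^+ u.+2 * V 0%N u u.+3) =
  f s * (V 0%N s s.+3 - V 0%N s s.+2)
  + q * (V 0%N 0%N 2 - V 0%N 0%N 1 - (V 0%N s s.+2 - V 0%N s s.+1)).
Proof.
elim: s => [|s IHs] lt_sm; first by rewrite big_geq // f0; ring.
rewrite big_nat_recr //= (IHs (ltnW lt_sm)) fS.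
rewrite (@VE 0%N s s.+1 (ltnW lt_sm)) (@VE 0%N s s.+2 lt_sm) !exprS; ring.
Qed.

Lemma telescope_sum : (0 < m)%N ->
  q ^+ m.+1 * V 0%N m.-1 m.+1 +
  \sum_(0 <= u < m.-1) (1 - f u.+1) * (q ^+ u.+2 * V 0%N u u.+3) =
  q * (V m.-1 1%N m.+1 - V m 0%N m.+1).
Proof.
move=> lt0m; have lt_mm : (m.-1 < m)%N by lia.
rewrite (telescope_columns lt_mm) telescope_rows // (prednK lt0m) V_last.
by rewrite (@VE 0%N m.-1 m) // V_last exprS; ring.
Qed.

End Telescope.

Section TilingValue.
Variable m : nat.

(** The coefficients q^i G(a, i) paired with a diagonal of the table of
    [normal_gf]; the column index j corresponds to a shift of i.  The truncation
    of a assigns to the start m.+2 the value at m.+1, which is the boundary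
    value that makes [tiling_value_rec] hold for a = m as well. *)
Definition tiling_value (k j a : nat) : {poly int} :=
  \sum_(0 <= i < m.+1)
    'X^i * tilings m (minn a m.+1) i * normal_gf (j + i + k) (j + i).

Lemma tiling_value_end k j a : (m < a)%N -> tiling_value k j a = normal_gf (j + k) j.
Proof.
move=> lt_ma; rewrite /tiling_value (minn_idPr lt_ma) big_ltn // big1_seq.
  by rewrite tilings_out // !eqxx addn0 !mul1r addr0.
move=> i; rewrite mem_index_iota => /andP[_ /andP[lt0i _]].
by rewrite tilings_out // gtn_eqF // mulr0 mul0r.
Qed.

Lemma tiling_value_rec k j a : (a <= m)%N -> tiling_value k j a =
  (1 - 'X^a) * tiling_value k j a.+1 + tiling_value k j.+1 a.+1
  - tiling_value k j.+1 a.+2.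
Proof.
rewrite leq_eqVlt => /orP[/eqP->|lt_am].
  rewrite (@tiling_value_end k j m.+1) // (@tiling_value_end k j.+1 m.+1) //.
  rewrite (@tiling_value_end k j.+1 m.+2) // addrK.
  rewrite /tiling_value (minn_idPl _) // big_ltn //.
  rewrite big1_seq ?addr0; first by rewrite tilings_last addn0 mul1r.
  move=> i; rewrite mem_index_iota => /andP[_ /andP[lt0i _]].
  by rewrite tilings_last gtn_eqF // mulr0 mul0r.
rewrite /tiling_value !(minn_idPl _) ?(leqW (ltnW lt_am)) //; try lia.
(* The top coefficient vanishes, so shifting the index i loses nothing. *)
have last0 b : (0 < b)%N -> tilings m b m = 0.
  by move=> lt0b; rewrite tilings_large //; lia.
rewrite [in LHS]big_nat_recl // [X in _ * X + _ - _]big_nat_recl //.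
rewrite mulrDr [X in _ + X - _]big_nat_recr // [X in _ - X]big_nat_recr //=.
rewrite !last0 // !mulr0 !mul0r !addr0.
rewrite -addrA -addrA; congr (_ + _).
  by rewrite !expr0 !mul1r (tilings_step _ (ltnW lt_am)) big_geq // mulr0 subr0 mulrA.
rewrite mulr_sumr -sumrB -big_split /=; apply: eq_bigr => i _.
rewrite tilings_three_term // !addnS !addSn; ring.
Qed.

Lemma tiling_value_row0 j a :
  tiling_value 0 j.+1 a - tiling_value 1 j a = 'X * tiling_value 0 j a.
Proof.
rewrite /tiling_value -sumrB big_distrr /=; apply: eq_bigr => i _.
rewrite !addn0 addSn addn1.
have := @normal_gf_step (j + i) (j + i) (leqnn _).
rewrite subSnn (@normal_gf_stable _ (j + i).+1) ?leqnSn // subrr add0r expr1.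
by move/(canRL (subrK _))=> ->; ring.
Qed.

Lemma tiling_value_row k j a :
  tiling_value k.+1 j.+1 a - tiling_value k.+2 j a =
  tiling_value k j.+1 a - tiling_value k.+1 j a + 'X^(k.+2) * tiling_value k.+1 j a.
Proof.
rewrite /tiling_value -!sumrB big_distrr -big_split /=; apply: eq_bigr => i _.
have := @normal_gf_step (j + i + k.+1) (j + i) (leq_addr _ _).
rewrite !addnS !addSn subSn; last by lia.
rewrite subSn ?leq_addr // addKn.
by move/(canRL (subrK _))=> ->; ring.
Qed.

End TilingValue.

Lemma psi0 : psi 0 = 0.
Proof. by rewrite /psi big_geq. Qed.

Lemma psiS t : psi t.+1 = psi t + 'X^(t.+2).
Proof. by rewrite /psi big_nat_recr. Qed.

Lemma psiE m : psi m = 'X * \sum_(1 <= j < m.+1) 'X^j.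
Proof.
elim: m => [|m IHm]; first by rewrite psi0 big_geq // mulr0.
by rewrite psiS IHm [in RHS]big_nat_recr //= mulrDr -exprS.
Qed.

(** The solution of the unitriangular system, b_w = q^(w+1) a_(w-1). *)
Definition shifted_gf (w : nat) : {poly int} := 'X^(w.+1) * normal_gf w.-1 w.-1.

Definition tiling_kernel (v w : nat) : {poly int} :=
  \sum_(1 <= t < w.+1) (1 - psi t) * tilings v t.+2 (w - t).

Lemma sum_triangle (W : nmodType) m (F : nat -> nat -> W) :
  \sum_(1 <= w < m) \sum_(1 <= t < w.+1) F t w =
  \sum_(1 <= t < m) \sum_(t <= w < m) F t w.
Proof.
transitivity (\sum_(1 <= w < m) \sum_(1 <= t < m | (t < w.+1)%N) F t w).
  by apply: eq_big_nat => w /andP[_ lt_wm]; rewrite (big_nat_widen _ _ m).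
rewrite (exchange_big_dep predT) //=; apply: eq_big_nat => t /andP[lt0t _].
by rewrite [RHS](big_nat_widenl _ 1).
Qed.

(** After the exchange of the sums over t and w, the inner sum is
    [tiling_value m 0 t.-1 t.+2], and the sum over t is the one that
    [telescope_sum] evaluates. *)
Lemma tiling_kernel_system m : (0 < m)%N ->
  shifted_gf m + \sum_(1 <= w < m) tiling_kernel m w * shifted_gf w = psi m.
Proof.
move=> lt0m.
have lastV k j : tiling_value m k j m.+2 = tiling_value m k j m.+1.
  by rewrite !tiling_value_end.
have := @telescope_sum _ 'X m _ (@tiling_value_rec m) lastV
  (tiling_value_row0 m) (tiling_value_row m) psi psi0 psiS lt0m.
rewrite !tiling_value_end // addn0 add1n (prednK lt0m) add0n normal_gf1 normal_gf0.
rewrite [1 + _]addrC addrK -psiE => <-; rewrite /shifted_gf; congr (_ + _).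
under eq_bigr => w _ do rewrite /tiling_kernel big_distrl /=.
rewrite (sum_triangle _ (fun t w => (1 - psi t) * tilings m t.+2 (w - t) *
  ('X^(w.+1) * normal_gf w.-1 w.-1))).
rewrite big_add1; apply: eq_big_nat => u /andP[_ lt_um].
under eq_bigr => w _ do rewrite -mulrA.
rewrite -mulr_sumr; congr (_ * _).
rewrite /tiling_value (minn_idPl _); last by lia.
rewrite [in RHS](@big_cat_nat _ _ _ (m - u.+1)) //=; last by lia.
rewrite [X in _ * (_ + X)]big1_seq ?addr0; last first.
  move=> i; rewrite mem_index_iota => lt_i.
  by rewrite tilings_large ?mulr0 ?mul0r //; lia.
rewrite -{1}[u.+1]add0n big_addn mulr_sumr; apply: eq_bigr => i _.
rewrite addnK addnS /= addn0 [(u + i)%N]addnC !exprS exprD; ring.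
Qed.

(** * Sums over chains invert unitriangular systems *)

Section ChainSum.
Variables (R : comNzRingType) (M : nat -> nat -> R).

Fixpoint chain_sum (s x i : nat) : R :=
  if s is s'.+1 then \sum_(0 <= y < x) M x y * chain_sum s' y i
  else if (i < x)%N then M x i else 0.

Lemma chain_sum_short s x i : (x <= i + s)%N -> chain_sum s x i = 0.
Proof.
elim: s x => [|s IHs] x /=; first by rewrite addn0 ltnNge => ->.
move=> le_x; rewrite big1_seq // => y; rewrite mem_index_iota => lt_yx.
by rewrite IHs ?mulr0 //; lia.
Qed.

Definition signed_chains (m i : nat) : R :=
  \sum_(0 <= s < m - i) (-1) ^+ s.+1 * chain_sum s m i.

Lemma signed_chains_widen m i S : (m - i <= S)%N ->
  signed_chains m i = \sum_(0 <= s < S) (-1) ^+ s.+1 * chain_sum s m i.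
Proof.
move=> le_S; rewrite [RHS](@big_cat_nat _ _ _ (m - i)) //=.
rewrite [X in _ + X]big1_seq ?addr0 // => s; rewrite mem_index_iota => lt_s.
by rewrite chain_sum_short ?mulr0 //; lia.
Qed.

(** The first step of a chain is split off; chains of one step give - M m i. *)
Lemma signed_chains_rec m i : (0 < i < m)%N ->
  signed_chains m i = - M m i - \sum_(1 <= w < m) M m w * signed_chains w i.
Proof.
move=> lt_im; rewrite /signed_chains.
have -> : (m - i = (m - i).-1.+1)%N by lia.
rewrite big_nat_recl //= (_ : (i < m)%N); last by lia.
rewrite expr1 mulN1r; congr (_ + _).
transitivity (\sum_(0 <= s < (m - i).-1) (-1) ^+ s.+2 *
    \sum_(1 <= w < m) M m w * chain_sum s w i).
  apply: eq_bigr => s _; congr (_ * _).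
  by rewrite big_ltn ?chain_sum_short ?mulr0 ?add0r //; lia.
under [LHS]eq_bigr => s _ do rewrite mulr_sumr.
rewrite exchange_big -sumrN /=; apply: eq_big_nat => w lt_wm.
rewrite -/(signed_chains w i) (@signed_chains_widen w i (m - i).-1); last by lia.
rewrite mulr_sumr -sumrN; apply: eq_bigr => s _.
by rewrite exprS; ring.
Qed.

(** Forward substitution: [signed_chains] satisfies the recurrence that defines the
    entries below the diagonal of the inverse of the matrix with entries M m w
    below a unit diagonal. *)
Lemma unitriangular_inverse N (b f : nat -> R) :
  (forall m, (0 < m <= N)%N -> b m + \sum_(1 <= w < m) M m w * b w = f m) ->
  forall m, (0 < m <= N)%N ->
  b m = f m + \sum_(1 <= i < m) f i * signed_chains m i.
Proof.
move=> eqb m; elim/ltn_ind: m => m IHm lt_m.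
have /(canRL (addrK _)) -> := eqb m lt_m; congr (_ + _).
rewrite -sumrN.
transitivity (\sum_(1 <= w < m) - (M m w * f w) +
   \sum_(1 <= w < m) \sum_(1 <= i < m) - (f i * (M m w * signed_chains w i))).
  rewrite -big_split; apply: eq_big_nat => w lt_wm /=.
  rewrite IHm; [|lia|lia]; rewrite mulrDr opprD; congr (_ + _).
  rewrite mulr_sumr -sumrN [RHS](@big_cat_nat _ _ _ w) //=; [|lia|lia].
  rewrite [X in _ = _ + X]big1_seq ?addr0; last first.
    move=> i; rewrite mem_index_iota => lt_i.
    by rewrite /signed_chains big_geq ?mulr0 ?oppr0 //; lia.
  by apply: eq_bigr => i _; ring.
rewrite exchange_big -big_split /=; apply: eq_big_nat => i lt_im.
rewrite signed_chains_rec // sumrN -mulr_sumr; ring.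
Qed.

Lemma sum_chains n s x i : (x < n)%N ->
  \sum_(v : s.+1.-tuple 'I_n | path gtn x (nat_vals v) && (nth 0%N (nat_vals v) s == i))
     \prod_(0 <= u < s.+1) M (nth 0%N (x :: nat_vals v) u) (nth 0%N (x :: nat_vals v) u.+1)
  = chain_sum s x i.
Proof.
elim: s x => [|s IHs] x lt_xn.
  rewrite (sum_tupleS _ _ (fun v => path gtn x v && (nth 0%N v 0 == i))
    (fun v => \prod_(0 <= u < 1) M (nth 0%N (x :: v) u) (nth 0%N (x :: v) u.+1))) /=.
  have [lt_ix|le_xi] := ltnP i x; last first.
    rewrite big1 // => y _; rewrite big_pred0 // => v.
    by apply/negP; lia.
  rewrite (bigD1 (Ordinal (ltn_trans lt_ix lt_xn))) //= [X in _ + X]big1 ?addr0.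
    rewrite (big_pred1 [tuple]) => [|v]; first by rewrite big_nat1.
    by rewrite [v]tuple0 /= lt_ix !eqxx.
  move=> y ne_y; rewrite big_pred0 // => v; apply/negP => /andP[_ eq_y].
  by case/eqP: ne_y; apply/val_inj/eqP.
rewrite (sum_tupleS _ _ (fun v => path gtn x v && (nth 0%N v s.+1 == i))
  (fun v => \prod_(0 <= u < s.+2) M (nth 0%N (x :: v) u) (nth 0%N (x :: v) u.+1))) /=.
rewrite -(@big_mkord _ _ _ n predT (fun y => \sum_(v : s.+1.-tuple 'I_n |
    (y < x)%N && path gtn y (nat_vals v) && (nth 0%N (nat_vals v) s == i))
  \prod_(0 <= u < s.+2) M (nth 0%N [:: x, y & nat_vals v] u) (nth 0%N (y :: nat_vals v) u))).
rewrite (@big_cat_nat _ _ _ x) //=; last by lia.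
rewrite [X in _ + X]big1_seq ?addr0; last first.
  move=> y; rewrite mem_index_iota => lt_y; rewrite big_pred0 // => v.
  by apply/negP; lia.
apply: eq_big_nat => y /andP[_ lt_yx]; rewrite lt_yx /= -IHs; last by lia.
rewrite mulr_sumr; apply: eq_bigr => v _.
by rewrite big_nat_recl.
Qed.

Lemma sum_is_chain n i s :
  \sum_(v : s.+2.-tuple 'I_n.+2 | is_chain n i s (nat_vals v))
    \prod_(0 <= u < s.+1) M (nth 0%N (nat_vals v) u) (nth 0%N (nat_vals v) u.+1)
  = chain_sum s n.+1 i.
Proof.
rewrite -(@sum_chains n.+2) // (sum_tupleS _ _ (is_chain n i s)
  (fun v => \prod_(0 <= u < s.+1) M (nth 0%N v u) (nth 0%N v u.+1))) /=.
rewrite (bigD1 ord_max) //= [X in _ + X]big1 ?addr0.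
  by apply: eq_bigl => v; rewrite /is_chain /= eqxx /= andbC.
move=> y ne_y; rewrite big_pred0 // => v; apply/negP => /and3P[/= eq_y _ _].
by case/eqP: ne_y; apply/val_inj/eqP.
Qed.

End ChainSum.

(** * The formula *)

Definition block_kernel (v w : nat) : {poly int} :=
  (1 - psi w) * Pi (w + 2) v
  + \sum_(1 <= t < w) (1 - psi t) *
      \sum_(1 <= r < (minn (v - w - 1) (w - t)).+1)
        \sum_(d : r.-tuple 'I_(w - t).+1 | is_composition (w - t) (nat_vals d))
          SigmaPi (t + 2) v [seq x.+1 | x <- nat_vals d].

(** The term t = w of the sum is the product without blocks.  For t < w there is at
    least one block, and the upper bound on r only discards sums with more
    blocks than there is room for or than there are units in w - t. *)
Lemma block_kernelE v w : (0 < w < v)%N -> block_kernel v w = tiling_kernel v w.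
Proof.
move=> lt_w; rewrite /block_kernel /tiling_kernel big_nat_recr /=; last by lia.
rewrite [LHS]addrC subnn addn2; congr (_ + _ * _); last first.
  by rewrite /tilings big_nat1 tiling_part0 /= block_sum_nil ltnS; case: ifP => //; lia.
apply: eq_big_nat => t lt_t; congr (_ * _); rewrite addn2.
rewrite /tilings [RHS]big_ltn // tiling_part0 ifF ?add0r; last by lia.
rewrite [RHS](@big_cat_nat _ _ _ (minn (v - w - 1) (w - t)).+1) //=; last by lia.
rewrite [X in _ = _ + X]big1_seq ?addr0; last first.
  move=> r; rewrite mem_index_iota => lt_r.
  by apply: tiling_part_large; lia.
apply: eq_big_nat => r /andP[lt0r _].
rewrite (sum_compositions r (fun d => SigmaPi t.+2 v [seq x.+1 | x <- d])) //.
apply: eq_big_seq => d /compositionsP[size_d _].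
by case: d size_d => [|x d] /= size_d; [lia|rewrite SigmaPiE].
Qed.

Theorem corollary4p5 (n : nat) (hn : (1 <= n)%N) :
  (fc_poincare n)%:F =
    ('X^(n.+2))%:F^-1 * (\sum_(2 <= j < n.+3) 'X^j)%:F
    + ('X^(n.+2))%:F^-1 *
      (\sum_(1 <= i < n.+1)
         (\sum_(2 <= j < i.+2) 'X^j) *
         \sum_(0 <= s < (n - i).+1)
           (-1) ^+ s.+1 *
           \sum_(v : s.+2.-tuple 'I_n.+2 | is_chain n i s (nat_vals v))
             \prod_(0 <= u < s.+1)
               let vu := nth 0%N (nat_vals v) u in
               let vu1 := nth 0%N (nat_vals v) u.+1 in
               ((1 - psi vu1) * Pi (vu1 + 2) vu
                + \sum_(1 <= t < vu1)
                    (1 - psi t) *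
                    \sum_(1 <= r < (minn (vu - vu1 - 1) (vu1 - t)).+1)
                      \sum_(d : r.-tuple 'I_(vu1 - t).+1 |
                              is_composition (vu1 - t) (nat_vals d))
                        SigmaPi (t + 2) vu [seq x.+1 | x <- nat_vals d]))%:F
    :> {fraction {poly int}}.
Proof.
have system m : (0 < m <= n.+1)%N ->
    shifted_gf m + \sum_(1 <= w < m) block_kernel m w * shifted_gf w = psi m.
  move=> /andP[lt0m _]; rewrite -(tiling_kernel_system lt0m); congr (_ + _).
  by apply: eq_big_nat => w lt_w; rewrite -block_kernelE.
have solved : shifted_gf n.+1 =
    psi n.+1 + \sum_(1 <= i < n.+1) psi i * signed_chains block_kernel n.+1 i.
  by apply: (unitriangular_inverse system); rewrite leqnn.
rewrite -[psi n.+1]/(\sum_(2 <= j < n.+3) 'X^j) in solved.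
rewrite -mulrDr -tofracD; set rhs := (X in _ * (_ + X)%:F).
have -> : rhs = \sum_(1 <= i < n.+1) psi i * signed_chains block_kernel n.+1 i.
  apply: eq_big_nat => i /andP[_ lt_in]; congr (_ * _).
  rewrite /signed_chains subSn //; apply: eq_bigr => s _; congr (_ * _).
  by rewrite -sum_is_chain.
rewrite -solved -[shifted_gf _]/('X^(n.+2) * normal_gf n n) -fc_poincare_normal_gf //.
have: 'X^(n.+2) != 0 :> {poly int} by rewrite expf_neq0 // polyX_eq0.
move: ('X^(n.+2) : {poly int}) => p; rewrite -tofrac_eq0 => p_neq0.
by rewrite tofracM mulKf.
Qed.
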